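(* Let $n\geq 2$, let $\Omega$ be a region (nonempty open connected subset) of $\mathbb{C}$, and let $F:\Omega\to\mathbb{M}_n$ be analytic. If there is a $z_0\in\Omega$ such that $\|F(z)\|\leq\|F(z_0)\|$ for all $z\in\Omega$, then there exist constant $n\times n$ unitary matrices $U$ and $V$ and an analytic function $G:\Omega\to\mathbb{M}_{n-1}$ such that \[F(z)=U\begin{bmatrix}\|F(z_0)\| & 0\\ 0 & G(z)\end{bmatrix}V\quad\text{for all } z\in\Omega.\]
   Context: $\mathbb{M}_n$ denotes the set of $n\times n$ complex matrices (the paper takes $n>1$ throughout). $\|T\|$ denotes the operator norm of $T\in\mathbb{M}_n$ induced by the Euclidean norm on $\mathbb{C}^n$. A function $F:\Omega\to\mathbb{M}_n$ is analytic if it is complex differentiable with respect to this norm, equivalently if every entry of $F$ is analytic on $\Omega$. A matrix $A$ is unitary if $A^*A=AA^*=I$. *)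

(* Defs.v *)
From HB Require Import structures.
From mathcomp Require Import all_boot all_order all_algebra.
From mathcomp Require Import all_classical all_reals all_analysis.
From mathcomp Require Import complex.

Set Implicit Arguments.
Unset Strict Implicit.
Unset Printing Implicit Defensive.

Import Order.TTheory GRing.Theory Num.Theory.
Import numFieldTopology.Exports numFieldNormedType.Exports.
Local Open Scope classical_set_scope.
Local Open Scope ring_scope.

(* The complex numbers C = R[i] over a real number type R; R[i] is a
   numClosedFieldType, hence a normed module over itself with norm the
   complex modulus, which gives the usual topology of the plane. *)

HB.instance Definition _ (R : rcfType) :=
  PseudoPointedMetric.copy R[i] (R[i])^o.
HB.instance Definition _ (R : rcfType) :=
  NormedModule.copy R[i] (R[i])^o.

Definition vnorm (R : realType) (n : nat) (v : 'cV[R[i]]_n) : R :=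
  Num.sqrt (\sum_(k < n) ((complex.Re (v k 0)) ^+ 2 + (complex.Im (v k 0)) ^+ 2)).

Definition opnorm (R : realType) (n : nat) (A : 'M[R[i]]_n) : R :=
  sup [set vnorm (A *m v) | v in [set v : 'cV[R[i]]_n | vnorm v <= 1]].

Definition adjmx (R : realType) (n : nat) (A : 'M[R[i]]_n) : 'M[R[i]]_n :=
  (map_mx Num.conj A)^T.

Definition unitary (R : realType) (n : nat) (A : 'M[R[i]]_n) : Prop :=
  adjmx A *m A = 1%:M /\ A *m adjmx A = 1%:M.

Definition region (R : realType) (Om : set R[i]) : Prop :=
  Om !=set0 /\ open Om /\ connected Om.

Definition mx_analytic_on (R : realType) (n : nat) (Om : set R[i])
  (F : R[i] -> 'M[R[i]]_n) : Prop :=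
  forall z, Om z -> forall i j : 'I_n,
    derivable (fun w : R[i] => F w i j) z (1 : R[i]).

(* Main.v *)
Require Import Defs.
From HB Require Import structures.
From mathcomp Require Import all_boot all_order all_algebra.
From mathcomp Require Import all_classical all_reals all_analysis.
From mathcomp Require Import complex ring lra.

(** Let M = ||F(z0)||, attained at a unit vector v, and write F(z0) v = M u with
u a unit vector. The scalar function z |-> <F(z) v, u> is analytic, bounded by M
by Cauchy-Schwarz, and takes the value M at z0, so it is constantly M by the
maximum modulus principle. Equality in Cauchy-Schwarz then forces F(z) v = M u
and F(z)^* u = M v for every z, and completing u and v to orthonormal bases
gives the block decomposition.

The maximum modulus principle is proved without assuming F' continuous. By
Goursat's bisection argument, a pointwise closed differentiable form has zero
integral around a rectangle; applied to f(a + h e^(x+iy)) on a rectangle of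
height 2 pi, it says that the mean of f over circles around a does not depend on
the radius, hence equals f(a). *)

Import Order.TTheory GRing.Theory Num.Theory.
Import numFieldTopology.Exports numFieldNormedType.Exports.
Local Open Scope classical_set_scope.
Local Open Scope ring_scope.
Local Open Scope complex_scope.

(** * Integrals of continuous functions over real segments *)

Section SegmentIntegral.
Context (R : realType).
Implicit Types (g : R -> R) (a b c e : R).

Definition segint g a b : R := \int[@lebesgue_measure R]_(x in `[a, b]) g x.

(** Continuity is taken in the whole line, also at the two ends, so that it passes to subsegments
    without boundary cases. *)
Definition cont_on g a b := forall x, a <= x <= b -> {for x, continuous g}.

Lemma continuous_for_dist g x :
  (forall e, 0 < e -> exists2 d, 0 < d &
     forall y, `|y - x| < d -> `|g y - g x| <= e) ->
  {for x, continuous g}.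
Proof.
move=> h; apply/cvgrPdist_le => e e0; have [d d0 hd] := h e e0.
apply/nbhs_ballP; exists d => //= y; rewrite /ball/= distrC => yx.
by rewrite distrC hd.
Qed.

Lemma cont_on_integrable g a b : cont_on g a b ->
  (@lebesgue_measure R).-integrable `[a, b] (EFin \o g).
Proof.
move=> cg; apply: continuous_compact_integrable; first exact: segment_compact.
by apply: continuous_in_subspaceT => x; rewrite inE /= in_itv /= => /cg.
Qed.

Lemma segint_split g a b c : a <= c -> c <= b -> cont_on g a b ->
  segint g a b = segint g a c + segint g c b.
Proof.
move=> ac cb cg; rewrite /segint.
have := @Rintegral_itvB R g (BLeft a) (BRight b) c (cont_on_integrable _ _ _ cg).
rewrite !bnd_simp => /(_ ac cb) h.
rewrite -(@Rintegral_itv_obnd_cbnd _ c); last first.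
  apply: integrableS (cont_on_integrable _ _ _ cg) => //.
  by apply: subset_itvr; rewrite bnd_simp.
by rewrite -h addrC subrK.
Qed.

Lemma segintB g h a b : cont_on g a b -> cont_on h a b ->
  segint (fun x => g x - h x) a b = segint g a b - segint h a b.
Proof. by move=> cg ch; rewrite /segint RintegralB//; exact: cont_on_integrable. Qed.

Lemma segint_cst k a b : a <= b -> segint (fun=> k) a b = k * (b - a).
Proof.
move=> ab; rewrite /segint Rintegral_cst//= lebesgue_measure_itv /= lte_fin.
case: ltP => [//|ba]; have -> : a = b by apply/eqP; rewrite eq_le ab ba.
by rewrite subrr.
Qed.

(** Monotonicity against the constants [c - e] and [c + e]; all later estimates compare an integrand
    with a constant in this way. *)
Lemma segint_bound g a b c e : a <= b -> cont_on g a b ->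
  (forall x, a <= x <= b -> `|g x - c| <= e) ->
  `|segint g a b - c * (b - a)| <= e * (b - a).
Proof.
move=> ab cg hg.
have ik k : (@lebesgue_measure R).-integrable `[a, b] (EFin \o (fun=> k)).
  by apply: cont_on_integrable => x _; exact: cvg_cst.
have ig := cont_on_integrable _ _ _ cg.
have lo : segint (fun=> c - e) a b <= segint g a b.
  apply: le_Rintegral => //= x; rewrite in_itv /= => /hg.
  by rewrite ler_norml; lra.
have hi : segint g a b <= segint (fun=> c + e) a b.
  apply: le_Rintegral => //= x; rewrite in_itv /= => /hg.
  by rewrite ler_norml; lra.
rewrite !segint_cst// in lo hi; rewrite ler_norml; apply/andP; split; lra.
Qed.

Lemma cont_onS g a b a' b' : a <= a' -> b' <= b -> cont_on g a b -> cont_on g a' b'.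
Proof.
by move=> h1 h2 cg x /andP[x1 x2]; apply: cg; rewrite (le_trans h1) ?(le_trans x2).
Qed.

Lemma segint_ge0 g a b : (forall x, a <= x <= b -> 0 <= g x) -> 0 <= segint g a b.
Proof. by move=> g0; apply: Rintegral_ge0 => x /=; rewrite in_itv/= => /g0. Qed.

(** A positive value at an interior point keeps [g] above half of it on a short segment around that
    point. The integral there is positive and the rest contributes nothing negative. *)
Lemma segint_eq0 g a b : cont_on g a b ->
  (forall x, a <= x <= b -> 0 <= g x) -> segint g a b = 0 ->
  forall x, a < x < b -> g x = 0.
Proof.
move=> cg g0 ig x /andP[ax xb].
have xab : a <= x <= b by rewrite !ltW.
apply/eqP; rewrite eq_le g0// andbT leNgt; apply/negP => gx.
have /cvgrPdist_le /(_ (g x / 2)) := cg x xab.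
rewrite divr_gt0// => /(_ isT) /nbhs_ballP[d /= d0 hd].
pose l := Num.max a (x - d / 2); pose r := Num.min b (x + d / 2).
have al : a <= l by rewrite le_max lexx.
have rb : r <= b by rewrite ge_min lexx.
have lx : l < x by rewrite gt_max ax /=; lra.
have xr : x < r by rewrite lt_min xb /=; lra.
have lr : l < r by apply: lt_trans xr.
have ld : x - d / 2 <= l by rewrite le_max lexx orbT.
have rd : r <= x + d / 2 by rewrite ge_min lexx orbT.
have pos : `|segint g l r - g x * (r - l)| <= g x / 2 * (r - l).
  apply: segint_bound; [exact: ltW|exact: cont_onS cg|] => y /andP[ly yr].
  rewrite distrC; apply: hd; rewrite /ball /= ltr_norml; apply/andP; split; lra.
move: ig; rewrite (segint_split g a b l)//; last by rewrite ltW// (lt_le_trans lr).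
rewrite (segint_split g l b r) ?(ltW lr)//; last exact: cont_onS cg.
have s1 : 0 <= segint g a l.
  by apply: segint_ge0 => y /andP[? yl]; apply: g0; lra.
have s2 : 0 <= segint g r b.
  by apply: segint_ge0 => y /andP[? yl]; apply: g0; lra.
have : 0 < g x / 2 * (r - l) by rewrite mulr_gt0 ?divr_gt0// subr_gt0.
move: pos; rewrite ler_norml => /andP[pos _]; lra.
Qed.

End SegmentIntegral.

(** * Goursat's theorem for closed forms on a rectangle *)

Section Goursat.
Context (R : realType).
Implicit Types (P Q : R -> R -> R).

(** Fréchet differentiability at a single point, with gradient [(a, b)] and the l1 norm on the
    plane. *)
Definition diff2_at P (x0 y0 a b : R) := forall e, 0 < e -> exists2 d, 0 < d &
  forall x y, `|x - x0| < d -> `|y - y0| < d ->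
    `|P x y - P x0 y0 - a * (x - x0) - b * (y - y0)| <= e * (`|x - x0| + `|y - y0|).

(* The form P dx + Q dy is closed at the point, [b] being the common value of
   dP/dy and dQ/dx; the partial derivatives need not be continuous. *)
Definition closed_form_at P Q (x0 y0 : R) :=
  exists a b c, diff2_at P x0 y0 a b /\ diff2_at Q x0 y0 b c.

Lemma diff2_at_sym P x0 y0 a b :
  diff2_at P x0 y0 a b -> diff2_at (fun y x => P x y) y0 x0 b a.
Proof.
move=> dP e e0; have [d d0 hd] := dP e e0; exists d => // y x hy hx.
by rewrite [_ - b * _ - _]addrAC [`|y - _| + _]addrC; exact: hd.
Qed.

Lemma diff2_at_continuous P x0 y0 a b :
  diff2_at P x0 y0 a b -> {for x0, continuous (fun x => P x y0)}.
Proof.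
move=> dP; apply: continuous_for_dist => e e0.
have [d d0 hd] := dP 1 ltr01.
have a1 : 0 < `|a| + 1 by rewrite ltr_wpDl.
exists (Num.min d (e / (`|a| + 1))) => [|x].
  by rewrite lt_min d0 divr_gt0.
rewrite lt_min => /andP[xd xe].
have := hd x y0 xd; rewrite subrr normr0 => /(_ d0).
rewrite mulr0 subr0 addr0 mul1r => h.
have -> : P x y0 - P x0 y0 = (P x y0 - P x0 y0 - a * (x - x0)) + a * (x - x0) by ring.
apply: le_trans (ler_normD _ _) _; rewrite normrM.
move: xe; rewrite ltr_pdivlMr// => /ltW; lra.
Qed.

(* The integral of P dx + Q dy along the counterclockwise boundary, with
   opposite sides paired so that only differences are ever estimated. *)
Definition rectint P Q (x1 x2 y1 y2 : R) : R :=
  segint R (fun x => P x y1 - P x y2) x1 x2 +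
  segint R (fun y => Q x2 y - Q x1 y) y1 y2.

(** Each right end bounds all left ends, so the supremum of the left ends lies in every segment. *)
Lemma nested_segments (a : nat -> R) (w : R) :
  (forall k, a k <= a k.+1 /\ a k.+1 + w / 2 ^+ k.+1 <= a k + w / 2 ^+ k) ->
  0 <= w ->
  exists p, forall k, a k <= p <= a k + w / 2 ^+ k.
Proof.
move=> ha w0.
have mono k j : a k <= a (k + j)%N /\ a (k + j)%N + w / 2 ^+ (k + j) <= a k + w / 2 ^+ k.
  elim: j => [|j [IH1 IH2]]; first by rewrite addn0.
  rewrite addnS; have [s1 s2] := ha (k + j)%N; split; [exact: le_trans IH1 s1|exact: le_trans s2 IH2].
have pos k : 0 <= w / 2 ^+ k by rewrite divr_ge0// exprn_ge0.
have ub k : ubound (range a) (a k + w / 2 ^+ k).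
  move=> _ [j _ <-]; have [kj|jk] := leqP k j.
    have [_] := mono k (j - k)%N; rewrite subnKC// => h.
    by apply: le_trans h; rewrite lerDl.
  have [h _] := mono j (k - j)%N; rewrite subnKC ?(ltnW jk)// in h.
  by rewrite (le_trans h)// lerDl.
have hs : has_sup (range a) by split; [exists (a 0%N); exists 0%N|exists (a 0%N + w / 2 ^+ 0)].
exists (sup (range a)) => k; apply/andP; split.
  by apply: sup_upper_bound => //; exists k.
by apply: sup_le_ub => //; case: hs.
Qed.

Context (P Q : R -> R -> R) (X1 X2 Y1 Y2 : R)
  (PQ : forall x y, X1 <= x <= X2 -> Y1 <= y <= Y2 -> closed_form_at P Q x y).

Let contP y : Y1 <= y <= Y2 -> cont_on R (fun x => P x y) X1 X2.
Proof. by move=> hy x hx; have [a [b [c [h _]]]] := PQ x y hx hy; exact: diff2_at_continuous h. Qed.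

Let contQ x : X1 <= x <= X2 -> cont_on R (fun y => Q x y) Y1 Y2.
Proof.
move=> hx y hy; have [a [b [c [_ h]]]] := PQ x y hx hy.
exact: diff2_at_continuous (diff2_at_sym _ _ _ _ _ h).
Qed.

Let contPB y y' : Y1 <= y <= Y2 -> Y1 <= y' <= Y2 ->
  cont_on R (fun x => P x y - P x y') X1 X2.
Proof. by move=> hy hy' x hx; apply: cvgB; [exact: contP hx|exact: contP hx]. Qed.

Let contQB x x' : X1 <= x <= X2 -> X1 <= x' <= X2 ->
  cont_on R (fun y => Q x y - Q x' y) Y1 Y2.
Proof. by move=> hy hy' x'' hx; apply: cvgB; [exact: contQ hx|exact: contQ hx]. Qed.

(** The affine parts integrate to zero: constants and the terms in [a] and [c] cancel between
    opposite sides, and the shared coefficient [b] contributes [- (b * w * k)] and [b * w * k]. Only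
    the remainders survive. *)
Lemma rectint_small x0 y0 : X1 <= x0 <= X2 -> Y1 <= y0 <= Y2 ->
  forall e, 0 < e -> exists2 d, 0 < d & forall x1 x2 y1 y2,
    X1 <= x1 -> x1 <= x0 -> x0 <= x2 -> x2 <= X2 ->
    Y1 <= y1 -> y1 <= y0 -> y0 <= y2 -> y2 <= Y2 ->
    x2 - x1 < d -> y2 - y1 < d ->
    `|rectint P Q x1 x2 y1 y2| <= e * (x2 - x1 + (y2 - y1)) ^+ 2.
Proof.
move=> hx0 hy0 e e0; have [a [b [c [dP dQ]]]] := PQ x0 y0 hx0 hy0.
have e2 : 0 < e / 2 by rewrite divr_gt0.
have [d1 d10 h1] := dP _ e2; have [d2 d20 h2] := dQ _ e2.
exists (Num.min d1 d2) => [|x1 x2 y1 y2 H1 H2 H3 H4 H5 H6 H7 H8].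
  by rewrite lt_min d10.
rewrite !lt_min => /andP[w1 w2] /andP[k1 k2].
set w := x2 - x1; set k := y2 - y1.
have bnd x y : x1 <= x <= x2 -> y1 <= y <= y2 ->
   [/\ `|x - x0| <= w, `|y - y0| <= k &
     (`|x - x0| < d1 /\ `|y - y0| < d1) /\ (`|x - x0| < d2 /\ `|y - y0| < d2)].
  move=> /andP[a1 a2] /andP[a3 a4].
  have A : `|x - x0| <= w by rewrite ler_norml /w; apply/andP; split; lra.
  have B : `|y - y0| <= k by rewrite ler_norml /k; apply/andP; split; lra.
  by do !split=> //; apply: le_lt_trans; eassumption.
have w0 : 0 <= w by rewrite subr_ge0 (le_trans H2).
have k0 : 0 <= k by rewrite subr_ge0 (le_trans H6).
have y11 : y1 <= y1 <= y2 by rewrite lexx (le_trans H6).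
have y22 : y1 <= y2 <= y2 by rewrite lexx (le_trans H6).
have x11 : x1 <= x1 <= x2 by rewrite lexx (le_trans H2).
have x22 : x1 <= x2 <= x2 by rewrite lexx (le_trans H2).
(* Subtracting the expansions of [P] at heights [y1] and [y2] leaves [b * (y1 - y2)] and two errors,
   each at most [e / 2 * (w + k)]. *)
have eP : `|segint R (fun x => P x y1 - P x y2) x1 x2 - (b * (y1 - y2)) * w| <= e * (w + k) * w.
  apply: segint_bound; first by case/andP: x11.
    by apply: (cont_onS _ _ X1 X2) => //; apply: contPB; lra.
  move=> x hx; have [A1 B1 [[C1 D1] _]] := bnd x y1 hx y11.
  have [_ B2 [[_ D2] _]] := bnd x y2 hx y22.
  have := h1 x y1 C1 D1; have := h1 x y2 C1 D2.
  have : e / 2 * (`|x - x0| + `|y1 - y0|) <= e / 2 * (w + k) by rewrite ler_pM2l// lerD.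
  have : e / 2 * (`|x - x0| + `|y2 - y0|) <= e / 2 * (w + k) by rewrite ler_pM2l// lerD.
  by rewrite !ler_norml => ? ? /andP[? ?] /andP[? ?]; apply/andP; split; lra.
have eQ : `|segint R (fun y => Q x2 y - Q x1 y) y1 y2 - (b * (x2 - x1)) * k| <= e * (w + k) * k.
  apply: segint_bound; first by case/andP: y11.
    by apply: (cont_onS _ _ Y1 Y2) => //; apply: contQB; lra.
  move=> y hy; have [A1 B1 [_ [C1 D1]]] := bnd x1 y x11 hy.
  have [A2 _ [_ [C2 _]]] := bnd x2 y x22 hy.
  have := h2 x1 y C1 D1; have := h2 x2 y C2 D1.
  have : e / 2 * (`|x1 - x0| + `|y - y0|) <= e / 2 * (w + k) by rewrite ler_pM2l// lerD.
  have : e / 2 * (`|x2 - x0| + `|y - y0|) <= e / 2 * (w + k) by rewrite ler_pM2l// lerD.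
  by rewrite !ler_norml => ? ? /andP[? ?] /andP[? ?]; apply/andP; split; lra.
rewrite /rectint; move: eP eQ; set I := segint _ _ _ _; set J := segint _ _ _ _.
have -> : b * (y1 - y2) * w = - (b * w * k) by rewrite /k; ring.
have -> : b * (x2 - x1) * k = b * w * k by [].
have -> : e * (w + k) ^+ 2 = e * (w + k) * w + e * (w + k) * k by ring.
by rewrite !ler_norml => /andP[? ?] /andP[? ?]; apply/andP; split; lra.
Qed.

(** The inner sides occur twice with opposite signs. *)
Lemma rectint_split x1 x2 y1 y2 xm ym :
  X1 <= x1 -> x1 <= xm -> xm <= x2 -> x2 <= X2 ->
  Y1 <= y1 -> y1 <= ym -> ym <= y2 -> y2 <= Y2 ->
  rectint P Q x1 x2 y1 y2 =
    rectint P Q x1 xm y1 ym + rectint P Q xm x2 y1 ym +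
    (rectint P Q x1 xm ym y2 + rectint P Q xm x2 ym y2).
Proof.
move=> H1 H2 H3 H4 H5 H6 H7 H8; rewrite /rectint.
have cP y a b : x1 <= a -> b <= x2 -> y1 <= y <= y2 -> cont_on R (fun x => P x y) a b.
  move=> ? ? ?; apply: (cont_onS _ _ X1 X2); [lra|lra|].
  by apply: contP; lra.
have cQ x a b : y1 <= a -> b <= y2 -> x1 <= x <= x2 -> cont_on R (fun y => Q x y) a b.
  move=> ? ? ?; apply: (cont_onS _ _ Y1 Y2); [lra|lra|].
  by apply: contQ; lra.
have h1 : y1 <= y1 <= y2 by lra.
have h2 : y1 <= y2 <= y2 by lra.
have h3 : y1 <= ym <= y2 by lra.
have h4 : x1 <= x1 <= x2 by lra.
have h5 : x1 <= x2 <= x2 by lra.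
have h6 : x1 <= xm <= x2 by lra.
rewrite !segintB; try (by apply: cP => //; lra); try (by apply: cQ => //; lra).
rewrite !(segint_split _ (P^~ _) x1 x2 xm)//; try (by apply: cP => //; lra).
rewrite !(segint_split _ _ y1 y2 ym)//; try (by apply: cQ => //; lra).
ring.
Qed.

(** By the triangle inequality, four quarters all below [c] cannot add up to [c *+ 4]. Writing the
    sides as [w + w] and [h + h] makes halving free of division. *)
Lemma rectint_quarter x y w h c : 0 < w -> 0 < h ->
  X1 <= x -> x + (w + w) <= X2 -> Y1 <= y -> y + (h + h) <= Y2 ->
  c *+ 4 <= `|rectint P Q x (x + (w + w)) y (y + (h + h))| ->
  exists x' y', [/\ x <= x', x' + w <= x + (w + w), y <= y', y' + h <= y + (h + h)
    & c <= `|rectint P Q x' (x' + w) y' (y' + h)|].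
Proof.
move=> w0 h0 g1 g2 g3 g4.
rewrite (rectint_split x (x + (w + w)) y (y + (h + h)) (x + w) (y + h)); try lra.
have {g2} -> : x + (w + w) = x + w + w by rewrite addrA.
have {g4} -> : y + (h + h) = y + h + h by rewrite addrA.
set K1 := rectint _ _ _ _ y _; set K2 := rectint _ _ _ _ y _.
set K3 := rectint _ _ x _ _ _; set K4 := rectint _ _ (x + w) _ _ _.
move=> hc.
have [c1|a1] := leP c `|K1|; first by exists x, y; split => //; lra.
have [c2|a2] := leP c `|K2|; first by exists (x + w), y; split => //; lra.
have [c3|a3] := leP c `|K3|; first by exists x, (y + h); split => //; lra.
have [c4|a4] := leP c `|K4|; first by exists (x + w), (y + h); split => //; lra.
exfalso; move: hc; apply/negP; rewrite -ltNge.
apply: le_lt_trans (ler_normD _ _) _.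
apply: le_lt_trans (lerD (ler_normD _ _) (ler_normD _ _)) _.
lra.
Qed.

(** Repeated quartering keeps the integral at least [eta] times the squared half-perimeter, while
    close to the common point of the rectangles it is at most half of that. *)
Theorem goursat : X1 < X2 -> Y1 < Y2 -> rectint P Q X1 X2 Y1 Y2 = 0.
Proof.
move=> X12 Y12; apply/eqP; rewrite -normr_eq0 eq_le normr_ge0 andbT leNgt.
apply/negP => K0.
pose w := X2 - X1; pose h := Y2 - Y1.
have w0 : 0 < w by rewrite subr_gt0.
have h0 : 0 < h by rewrite subr_gt0.
(* This ratio survives quartering: the lower bound for the integral and the squared half-perimeter
   are both divided by four. *)
pose eta := `|rectint P Q X1 X2 Y1 Y2| / (w + h) ^+ 2.
have wh0 : 0 < (w + h) ^+ 2 by rewrite exprn_gt0// addr_gt0.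
have eta0 : 0 < eta by rewrite divr_gt0.
pose W k : R := w / 2 ^+ k; pose H k : R := h / 2 ^+ k.
have pos2 k : (0 : R) < 2 ^+ k by rewrite exprn_gt0.
have W0 k : 0 < W k by rewrite divr_gt0.
have H0 k : 0 < H k by rewrite divr_gt0.
have half (c : R) k : c / 2 ^+ k = c / 2 ^+ k.+1 + c / 2 ^+ k.+1.
  by rewrite exprS; field; rewrite gt_eqF.
have WS k : W k = W k.+1 + W k.+1 by exact: half.
have HS k : H k = H k.+1 + H k.+1 by exact: half.
pose good k (p : R * R) := [/\ X1 <= p.1, p.1 + W k <= X2, Y1 <= p.2, p.2 + H k <= Y2 &
  eta * (W k + H k) ^+ 2 <= `|rectint P Q p.1 (p.1 + W k) p.2 (p.2 + H k)|].
pose step k (p q : R * R) := [/\ p.1 <= q.1, q.1 + W k.+1 <= p.1 + W k,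
  p.2 <= q.2 & q.2 + H k.+1 <= p.2 + H k].
(* Stated as an implication so that one choice function serves all arguments; a pair that is not
   good is sent to itself. *)
have next (kp : nat * (R * R)) : exists q, good kp.1 kp.2 -> good kp.1.+1 q /\ step kp.1 kp.2 q.
  case: kp => k [x y] /=.
  have [[/= g1 g2 g3 g4 g5]|ng] := pselect (good k (x, y)); last by exists (x, y).
  rewrite (WS k) in g2 g5; rewrite (HS k) in g4 g5.
  have E4 : eta * (W k.+1 + W k.+1 + (H k.+1 + H k.+1)) ^+ 2
            = eta * (W k.+1 + H k.+1) ^+ 2 *+ 4 by ring.
  rewrite E4 in g5.
  have [x' [y' [a1 a2 a3 a4 a5]]] :=
    rectint_quarter _ _ _ _ _ (W0 k.+1) (H0 k.+1) g1 g2 g3 g4 g5.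
  exists (x', y') => _; split; split; rewrite /fst /snd.
  - exact: le_trans g1 a1.
  - exact: le_trans a2 g2.
  - exact: le_trans g3 a3.
  - exact: le_trans a4 g4.
  - exact: a5.
  - exact: a1.
  - by rewrite (WS k); exact: a2.
  - exact: a3.
  - by rewrite (HS k); exact: a4.
have [nx hnx] := choice next.
pose p := fix p k : R * R := if k is j.+1 then nx (j, p j) else (X1, Y1).
have gp k : good k (p k).
  elim: k => [|k IH] /=; last by have [] := hnx (k, p k) IH.
  rewrite /good /= /W /H expr0 !divr1 /w /h.
  have -> : X1 + (X2 - X1) = X2 by ring.
  have -> : Y1 + (Y2 - Y1) = Y2 by ring.
  by split => //; rewrite -/w -/h /eta divfK// gt_eqF.
have sp k : step k (p k) (p k.+1) by have [] := hnx (k, p k) (gp k).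
have [x0 hx0] : exists q, forall k, (p k).1 <= q <= (p k).1 + w / 2 ^+ k.
  by apply: (nested_segments (fun k => (p k).1)); [move=> k; case: (sp k)|exact: ltW].
have [y0 hy0] : exists q, forall k, (p k).2 <= q <= (p k).2 + h / 2 ^+ k.
  by apply: (nested_segments (fun k => (p k).2)); [move=> k; case: (sp k)|exact: ltW].
have x0in : X1 <= x0 <= X2.
  by case: (gp 0%N) => a1 a2 _ _ _; have := hx0 0%N; rewrite -/(W 0%N); lra.
have y0in : Y1 <= y0 <= Y2.
  by case: (gp 0%N) => _ _ a1 a2 _; have := hy0 0%N; rewrite -/(H 0%N); lra.
have eta2 : 0 < eta / 2 by rewrite divr_gt0.
have [d d0 hd] := rectint_small x0 y0 x0in y0in _ eta2.
(* Any [k] above [(w + h) / d] works, since [2 ^ k] exceeds [k]. *)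
have [k hk] : exists k, W k < d /\ H k < d.
  have [k hk] : exists k : nat, (w + h) / d < k%:R.
    exists (Num.bound ((w + h) / d)).
    by apply: archi_boundP; rewrite ltW// divr_gt0// addr_gt0.
  have k2 : (k%:R : R) < 2 ^+ k by rewrite -natrX ltr_nat ltn_expl.
  move: hk; rewrite ltr_pdivrMr// => hk; exists k.
  have : k%:R * d < 2 ^+ k * d by rewrite ltr_pM2r.
  by rewrite /W /H !ltr_pdivrMr// ![d * _]mulrC; lra.
case: (gp k) => a1 a2 a3 a4 a5.
case/andP: (hx0 k) => b1 b2; case/andP: (hy0 k) => b3 b4.
have := hd _ _ _ _ a1 b1 b2 a2 a3 b3 b4 a4.
have -> : (p k).1 + w / 2 ^+ k - (p k).1 = W k by rewrite /W; ring.
have -> : (p k).2 + h / 2 ^+ k - (p k).2 = H k by rewrite /H; ring.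
case: hk => hk1 hk2 => /(_ hk1 hk2) hh.
have : 0 < eta * (W k + H k) ^+ 2 by rewrite mulr_gt0// exprn_gt0// addr_gt0.
by have := le_trans a5 hh; lra.
Qed.

End Goursat.

(** * The complex modulus and complex differentiability with real bounds *)

Section Modulus.
Context (R : realType).
Implicit Types (z w h : R[i]).
Local Notation normc := (@ComplexField.Normc.normc R).

Lemma norm_normc z : `|z| = (normc z)%:C.
Proof. by []. Qed.

Lemma normc_ge0 z : 0 <= normc z.
Proof. by case: z => x y; exact: sqrtr_ge0. Qed.

Lemma normcB z w : normc (z - w) = normc (w - z).
Proof. by rewrite -opprB normcN. Qed.

Lemma norm_Re_le z : `|complex.Re z| <= normc z.
Proof. by have := normc_ge_Re z; rewrite norm_normc lecR. Qed.

Lemma norm_Im_le z : `|complex.Im z| <= normc z.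
Proof.
by case: z => x y /=; rewrite -sqrtr_sqr ler_wsqrtr// lerDr sqr_ge0.
Qed.

Lemma normc_le z : normc z <= `|complex.Re z| + `|complex.Im z|.
Proof.
case: z => x y /=; rewrite -[leRHS]ger0_norm ?addr_ge0// -sqrtr_sqr ler_wsqrtr//.
rewrite sqrrD !real_normK ?num_real// -addrA [_ *+ 2 + _]addrC addrA lerDl.
by rewrite mulrn_wge0// mulr_ge0.
Qed.

(** Radii of balls in [R[i]] are themselves complex; a positive one is real, so real radii
    suffice. *)
Lemma open_normcP (A : set R[i]) :
  open A <-> forall a, A a -> exists2 r : R, 0 < r & forall h, normc h < r -> A (a + h).
Proof.
rewrite openE; split=> hA a Aa.
  have /nbhs_ballP[r /= r0 rA] := hA a Aa.
  have rr : r = (complex.Re r)%:C by rewrite RRe_real// gtr0_real.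
  exists (complex.Re r) => [|h hr]; first by rewrite rr ltcR in r0.
  apply: rA; rewrite /ball /= opprD addNKr normrN rr norm_normc ltcR//.
have [r r0 rA] := hA a Aa; apply/nbhs_ballP; exists r%:C; first by rewrite /= ltcR.
move=> y; rewrite /ball /= => ya; rewrite -(subrK a y) addrC; apply: rA.
by rewrite normcB -ltcR -norm_normc.
Qed.

(** The first-order expansion with derivative [c], free of quotients and with real [e] and [d],
    ready for the estimates on real forms. *)
Definition cdiff_at (f : R[i] -> R[i]) z c := forall e : R, 0 < e ->
  exists2 d : R, 0 < d & forall h, normc h < d ->
    normc (f (z + h) - f z - c * h) <= e * normc h.

Lemma derivable_cdiff_at (f : R[i] -> R[i]) z :
  derivable f z (1 : R[i]) -> exists c, cdiff_at f z c.
Proof.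
move=> df; exists ('D_1 f z) => e e0.
have /eqaddoP := derivable_nbhs df.
move=> /(_ e%:C); rewrite ltcR => /(_ e0).
move/nbhs_ballP => [r /= r0 hr].
have rr : r = (complex.Re r)%:C by rewrite RRe_real// gtr0_real.
exists (complex.Re r) => [|h hd]; first by rewrite rr ltcR in r0.
have /hr : ball (0 : R[i]) r h by rewrite /ball /= sub0r normrN rr norm_normc ltcR.
rewrite /= -![(_ + _ : _ -> _) _]/(_ + _) -![(- _ : _ -> _) _]/(- _) /=.
rewrite -lecR -norm_normc rmorphM /= -[X in _ <= _ * X -> _]norm_normc => H.
apply: le_trans H.
rewrite le_eqVlt; apply/orP; left; apply/eqP; congr (`|_|).
rewrite /cst /= opprD addrA [h *: 1]mulr1 [h *: _]mulrC. 
by rewrite [z + h]addrC.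
Qed.

Lemma cdiff_at_continuous f z c : cdiff_at f z c -> forall e : R, 0 < e ->
  exists2 d : R, 0 < d & forall h, normc h < d -> normc (f (z + h) - f z) <= e.
Proof.
move=> df e e0; have [d d0 hd] := df 1 ltr01.
have c1 : 0 < normc c + 1 by rewrite ltr_wpDl// normc_ge0.
exists (Num.min d (e / (normc c + 1))) => [|h].
  by rewrite lt_min d0 divr_gt0.
rewrite lt_min => /andP[/hd H].
rewrite ltr_pdivlMr// => /ltW he.
have -> : f (z + h) - f z = (f (z + h) - f z - c * h) + c * h by rewrite subrK.
apply: le_trans (le_normcD _ _) _; rewrite ComplexField.Normc.normcM.
rewrite mul1r in H; lra.
Qed.

End Modulus.

(** * Logarithmic polar coordinates *)

Section ExpCoordinates.
Context (R : realType).
Local Notation normc := (@ComplexField.Normc.normc R).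

(** With log-radius [x] and angle [y], circles become vertical segments, and shrinking a circle
    means letting [x] tend to minus infinity. *)
Definition cexp (x y : R) : R[i] := (expR x * cos y) +i* (expR x * sin y).

Lemma cexpD x y x' y' : cexp (x + x') (y + y') = cexp x y * cexp x' y'.
Proof.
rewrite /cexp expRD cosD sinD; apply/eqP; rewrite eq_complex /=.
by apply/andP; split; apply/eqP; ring.
Qed.

Lemma cexp0 : cexp 0 0 = 1.
Proof. by rewrite /cexp expR0 cos0 sin0 mul1r mulr0. Qed.

Lemma normc_cexp x y : normc (cexp x y) = expR x.
Proof.
rewrite /= !exprMn -mulrDr cos2Dsin2 mulr1 sqrtr_sqr ger0_norm//.
Qed.

Lemma is_derive_small (g : R -> R) (dg : R) : is_derive (0 : R) (1 : R) g dg ->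
  forall e : R, 0 < e -> exists2 d : R, 0 < d &
   forall x, `|x| < d -> `|g x - g 0 - dg * x| <= e * `|x|.
Proof.
move=> [dg1 <-] e e0.
have /eqaddoP := derivable_nbhs dg1.
move=> /(_ e e0) /nbhs_ballP[r /= r0 hr]; exists r => // x xr.
have /hr : ball (0 : R) r x by rewrite /ball /= sub0r normrN.
rewrite /= -![(_ + _ : _ -> _) _]/(_ + _) -![(- _ : _ -> _) _]/(- _) /=.
by rewrite /cst /= opprD addrA addr0 [x *: 1]mulr1 [x *: _]mulrC.
Qed.

(** The exponential has derivative 1 at 0; [cexpD] carries this to every other point. *)
Lemma cexp_small (e : R) : 0 < e -> exists2 d : R, 0 < d & forall x y,
  `|x| < d -> `|y| < d -> normc (cexp x y - 1 - (x +i* y)) <= e * (`|x| + `|y|).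
Proof.
move=> e0; have e4 : 0 < e / 4 by rewrite divr_gt0.
have [d1 d10 h1] := is_derive_small _ _ (is_derive_expR 0) _ e4.
have [d2 d20 h2] := is_derive_small _ _ (is_derive_sin 0) _ e4.
have [d3 d30 h3] := is_derive_small _ _ (is_derive_cos 0) _ e4.
have [d4 d40 h4] := is_derive_small _ _ (is_derive_expR 0) _ ltr01.
(* The bound [1 / 2] gives e^x at most 2, and [e / 8] absorbs the product of e^x - 1 with [y]. *)
pose d := Num.min (Num.min d1 d2) (Num.min (Num.min d3 d4) (Num.min (1 / 2) (e / 8))).
exists d => [|x y]; first by rewrite !lt_min d10 d20 d30 d40 !divr_gt0.
rewrite !lt_min => /andP[/andP[x1 x2] /andP[/andP[x3 x4] /andP[x5 x6]]].
move=> /andP[/andP[y1 y2] /andP[/andP[y3 y4] /andP[y5 y6]]].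
move: (h1 x x1) (h2 y y2) (h3 y y3) (h4 x x4).
rewrite !expR0 !sin0 !cos0 oppr0 mul0r !mul1r !(subr0, addr0) => A B C D.
have E2 : `|expR x| <= 2.
  have -> : expR x = (expR x - 1 - x) + (1 + x) by ring.
  apply: le_trans (ler_normD _ _) _.
  have := ler_normD 1 x; rewrite normr1; lra.
have E1 : `|expR x - 1| <= 2 * `|x|.
  have -> : expR x - 1 = (expR x - 1 - x) + x by ring.
  apply: le_trans (ler_normD _ _) _; lra.
apply: le_trans (normc_le _ _) _ => /=.
rewrite oppr0 addr0.
have -> : expR x * cos y - 1 - x = expR x * (cos y - 1) + (expR x - 1 - x) by ring.
have -> : expR x * sin y - y = expR x * (sin y - y) + (expR x - 1) * y by ring.
have n1 := ler_normD (expR x * (cos y - 1)) (expR x - 1 - x).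
have n2 := ler_normD (expR x * (sin y - y)) ((expR x - 1) * y).
rewrite !normrM in n1 n2.
have m1 : `|expR x| * `|cos y - 1| <= 2 * (e / 4 * `|y|) by rewrite ler_pM.
have m2 : `|expR x| * `|sin y - y| <= 2 * (e / 4 * `|y|) by rewrite ler_pM//.
have m3 : `|expR x - 1| * `|y| <= 2 * `|x| * (e / 8) by rewrite ler_pM// ltW.
have ? : 0 <= e * `|x| by rewrite mulr_ge0// ltW.
have ? : 0 <= e * `|y| by rewrite mulr_ge0// ltW.
lra.
Qed.

(* With phi(x, y) = f(a + k e^(x+iy)), the form Im phi dx + Re phi dy is the
   imaginary part of phi dw, w = x + iy; closedness is Cauchy-Riemann. *)
Lemma exp_coords_closed_form (f : R[i] -> R[i]) (a k c : R[i]) (x0 y0 : R) :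
  cdiff_at R f (a + k * cexp x0 y0) c ->
  closed_form_at R (fun x y => complex.Im (f (a + k * cexp x y)))
                   (fun x y => complex.Re (f (a + k * cexp x y))) x0 y0.
Proof.
move=> df; set w := k * cexp x0 y0 in df.
pose phi x y := f (a + k * cexp x y).
(* Chain rule: as a function of x + iy, [phi] has derivative [c * w], because the exponential
   reproduces itself. *)
have key : forall e : R, 0 < e -> exists2 d : R, 0 < d & forall x y,
    `|x - x0| < d -> `|y - y0| < d ->
    normc (phi x y - phi x0 y0 - c * w * ((x - x0) +i* (y - y0)))
      <= e * (`|x - x0| + `|y - y0|).
  move=> e e0.
  pose B := normc w + 1.
  have B0 : 0 < B by rewrite ltr_wpDl// normc_ge0.
  have cw0 := normc_ge0 _ (c * w).
  pose B' := normc (c * w) + 1.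
  have B'0 : 0 < B' by rewrite ltr_wpDl.
  (* The increment [u] is at most [2 * B] times the l1 distance, so this constant costs half of [e];
     the remainder of the exponential takes the other half. *)
  have e1 : 0 < e / (4 * B) by rewrite divr_gt0// mulr_gt0.
  have [d1 d10 h1] := df _ e1.
  have e2 : 0 < e / (2 * B') by rewrite divr_gt0// mulr_gt0.
  have [d2 d20 h2] := cexp_small _ e2.
  have [d3 d30 h3] := cexp_small _ ltr01.
  pose d := Num.min d2 (Num.min d3 (d1 / (4 * B))).
  exists d => [|x y]; first by rewrite !lt_min d20 d30 divr_gt0// mulr_gt0.
  rewrite !lt_min => /andP[x2 /andP[x3 x1]] /andP[y2 /andP[y3 y1]].
  set X := x - x0 in x1 x2 x3 *; set Y := y - y0 in y1 y2 y3 *.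
  have EE : cexp x y = cexp x0 y0 * cexp X Y.
    by rewrite -cexpD /X /Y; congr cexp; ring.
  pose u := w * (cexp X Y - 1).
  have Eu : a + k * cexp x y = a + w + u by rewrite EE /u /w; ring.
  have H2 := h2 X Y x2 y2; have H3 := h3 X Y x3 y3.
  have nXY : normc (X +i* Y) <= `|X| + `|Y| by exact: normc_le.
  have n1 : normc (cexp X Y - 1) <= 2 * (`|X| + `|Y|).
    have -> : cexp X Y - 1 = (cexp X Y - 1 - (X +i* Y)) + (X +i* Y) by rewrite subrK.
    apply: le_trans (le_normcD _ _) _; lra.
  have nu : normc u <= B * (2 * (`|X| + `|Y|)).
    rewrite ComplexField.Normc.normcM ler_pM ?normc_ge0//.
    by rewrite /B lerDl.
  have ud : normc u < d1.
    apply: le_lt_trans nu _.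
    move: x1 y1; rewrite !ltr_pdivlMr ?mulr_gt0//; lra.
  have := h1 u ud; rewrite -Eu.
  have -> : phi x y - phi x0 y0 - c * w * (X +i* Y) =
     (phi x y - phi x0 y0 - c * u) + c * w * (cexp X Y - 1 - (X +i* Y)).
    by rewrite /u; ring.
  move=> H1; apply: le_trans (le_normcD _ _) _.
  rewrite ComplexField.Normc.normcM.
  have S0 : 0 <= `|X| + `|Y| by rewrite addr_ge0.
  have A1 : e / (4 * B) * normc u <= e / 2 * (`|X| + `|Y|).
    apply: le_trans (_ : e / (4 * B) * (B * (2 * (`|X| + `|Y|))) <= _).
      by rewrite ler_pM2l.
    rewrite le_eqVlt; apply/orP; left; apply/eqP; field; rewrite gt_eqF//.
  have A2 : normc (c * w) * normc (cexp X Y - 1 - (X +i* Y)) <= e / 2 * (`|X| + `|Y|).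
    apply: le_trans (_ : B' * (e / (2 * B') * (`|X| + `|Y|)) <= _).
      by rewrite ler_pM ?normc_ge0// /B' lerDl.
    rewrite le_eqVlt; apply/orP; left; apply/eqP; field; rewrite gt_eqF//.
  rewrite -/w -/(phi x y) -/(phi x0 y0) in H1 *; lra.
(* For [c * w] = p + iq, the product with X + iY has imaginary part qX + pY and real part pX - qY;
   the common coefficient is p. *)
exists (complex.Im (c * w)), (complex.Re (c * w)), (- complex.Im (c * w)).
split=> e e0; have [d d0 hd] := key e e0; exists d => // x y hx hy.
  apply: le_trans (hd x y hx hy); apply: le_trans (norm_Im_le _ _).
  rewrite -/(phi x y) -/(phi x0 y0) le_eqVlt; apply/orP; left; apply/eqP; congr (`|_|).
  by case: (phi x y) (phi x0 y0) (c * w) => [? ?] [? ?] [? ?] /=; ring.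
apply: le_trans (hd x y hx hy); apply: le_trans (norm_Re_le _ _).
rewrite -/(phi x y) -/(phi x0 y0) le_eqVlt; apply/orP; left; apply/eqP; congr (`|_|).
by case: (phi x y) (phi x0 y0) (c * w) => [? ?] [? ?] [? ?] /=; ring.
Qed.

End ExpCoordinates.

(** * The maximum modulus principle, first on a disc and then on a region *)

Section MaximumModulus.
Context (R : realType).
Local Notation normc := (@ComplexField.Normc.normc R).

(** The mean of Re f over a circle around [a] equals [M], while Re f is at most [M]; hence Re f is
    [M] along the circle through [a + h], in particular at that point. *)
Lemma local_maximum_modulus (f : R[i] -> R[i]) (a : R[i]) (r M : R) :
  (forall h, normc h < r -> exists c, cdiff_at R f (a + h) c) ->
  (forall h, normc h < r -> normc (f (a + h)) <= M) ->
  f a = M%:C ->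
  forall h, normc h < r -> f (a + h) = M%:C.
Proof.
move=> df fM fa h hr.
pose P x y := complex.Im (f (a + h * cexp R x y)).
pose Q x y := complex.Re (f (a + h * cexp R x y)).
have h0 := normc_ge0 _ h.
have inr x y : x <= 0 -> normc (h * cexp R x y) < r.
  move=> x0; rewrite ComplexField.Normc.normcM normc_cexp; apply: le_lt_trans hr.
  by rewrite ler_piMr// -expR0 ler_expR.
have PQ x y : x <= 0 -> closed_form_at R P Q x y.
  by move=> x0; have [c hc] := df _ (inr x y x0); exact: exp_coords_closed_form hc.
have pi0 : 0 < pi :> R by exact: pi_gt0.
have Qcont x : x <= 0 -> cont_on R (Q x) (- pi) pi.
  move=> x0 y _; have [b1 [b2 [b3 [_ hQ]]]] := PQ x y x0.
  exact: diff2_at_continuous (diff2_at_sym _ _ _ _ _ _ hQ).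
(* The horizontal sides of the rectangle cancel because e^(x+iy) has period
   2 pi i. *)
have mean s : s < 0 -> segint R (Q 0) (- pi) pi = segint R (Q s) (- pi) pi.
  move=> s0.
  have := @goursat R P Q s 0 (- pi) pi.
  have H : forall x y, s <= x <= 0 -> - pi <= y <= pi -> closed_form_at R P Q x y.
    by move=> x y /andP[_ x0] _; exact: PQ.
  have pp : - pi < pi :> R by lra.
  move=> /(_ H s0 pp); rewrite /rectint.
  have -> : (fun x => P x (- pi) - P x pi) = fun=> 0.
    by apply/funext => x; rewrite /P /cexp cosN sinN sinpi oppr0 subrr.
  rewrite (segint_cst _ _ _ _ (ltW s0)) mul0r add0r (segintB _ (Q 0) (Q s)).
  - by move/eqP; rewrite subr_eq0 => /eqP.
  - exact: Qcont.
  - by apply: Qcont; exact: ltW.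
have QM y : Q 0 y <= M.
  apply: le_trans (ler_norm _) _; apply: le_trans (norm_Re_le _ _) _.
  by apply/fM/inr.
(* The mean is moved to a circle so small that f differs from [f a] by at most [e]. *)
have small e : 0 < e -> segint R (fun y => M - Q 0 y) (- pi) pi <= e * (pi - - pi).
  move=> e0.
  have r0 : normc 0 < r by rewrite ComplexField.Normc.normc0; exact: le_lt_trans hr.
  have [c0] := df 0 r0; rewrite addr0 => /cdiff_at_continuous /(_ e e0) [d d0 hd].
  (* Since e^(q+1) is at least q + 2, the radius [normc h] times e^s falls below [d]; the added 1
     also makes [s] negative. *)
  pose q := normc h / d; have q0 : 0 <= q by rewrite divr_ge0// ltW.
  pose s := - (q + 1); have s0 : s < 0 by rewrite /s; lra.
  have hs y : `|Q s y - M| <= e.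
    have -> : Q s y - M = complex.Re (f (a + h * cexp R s y) - f a).
      by rewrite fa /Q; case: (f _).
    apply: le_trans (norm_Re_le _ _) _; apply: hd.
    rewrite ComplexField.Normc.normcM normc_cexp /s expRN.
    rewrite ltr_pdivrMr ?expR_gt0//.
    have := expR_ge1Dx (q + 1).
    have hq : normc h = q * d by rewrite /q divfK// gt_eqF.
    rewrite hq mulrC ltr_pM2l// => ?; lra.
  have cM : cont_on R (fun=> M) (- pi) pi by move=> y _; exact: cvg_cst.
  rewrite segintB//; last exact: Qcont.
  rewrite (mean s)// -segintB//; last by apply: Qcont; exact: ltW.
  have := segint_bound R (fun y => M - Q s y) (- pi) pi 0 e.
  rewrite mul0r subr0 => H; apply: le_trans (ler_norm _) _; apply: H => //; first lra.
    by move=> y hy; apply: cvgB; [exact: cvg_cst|by apply: (Qcont s) => //; exact: ltW].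
  by move=> y _; rewrite subr0 distrC.
have g0 y : 0 <= M - Q 0 y by rewrite subr_ge0.
have int0 : segint R (fun y => M - Q 0 y) (- pi) pi = 0.
  apply/eqP; rewrite eq_le segint_ge0// andbT; apply/ler_addgt0Pr => e e0.
  have e1 : 0 < e / (pi - - pi) by rewrite divr_gt0//; lra.
  rewrite add0r; apply: le_trans (small _ e1) _.
  by rewrite divfK// gt_eqF//; lra.
have Q00 : M - Q 0 0 = 0.
  apply: (segint_eq0 R (fun y => M - Q 0 y) (- pi) pi _ _ int0) => //; last by lra.
  by move=> y hy; apply: cvgB; [exact: cvg_cst|exact: Qcont hy].
(* A real part equal to [M] and a modulus at most [M] leave no room for an imaginary part. *)
have := fM h hr; move: Q00; rewrite /Q cexp0 mulr1.
case: (f (a + h)) => x y /= /eqP; rewrite subr_eq0 => /eqP <- hM.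
have M0 : 0 <= M by apply: le_trans hM; exact: sqrtr_ge0.
have : M ^+ 2 + y ^+ 2 <= M ^+ 2.
  by rewrite -ler_sqrt ?sqr_ge0// [leRHS]sqrtr_sqr ger0_norm.
rewrite gerDl => y2; congr (_ +i* _); apply/eqP.
by rewrite -sqrf_eq0 eq_le y2 sqr_ge0.
Qed.

(** The set where f takes the value [M] is open by the local principle and relatively closed by
    continuity, so connectedness makes it all of [Om]. *)
Theorem maximum_modulus (Om : set R[i]) (f : R[i] -> R[i]) (z0 : R[i]) (M : R) :
  region Om -> (forall z, Om z -> derivable f z (1 : R[i])) -> Om z0 ->
  (forall z, Om z -> normc (f z) <= M) -> f z0 = M%:C ->
  forall z, Om z -> f z = M%:C.
Proof.
move=> [_ [oOm cOm]] df Oz0 fM fz0.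
have /open_normcP opOm := oOm.
pose B := Om `&` [set z | f z = M%:C].
pose C := Om `&` [set z | f z <> M%:C].
have oB : open B.
  apply/open_normcP => a [Oa fa]; have [r r0 hr] := opOm a Oa.
  exists r => // h hh; split; first exact: hr.
  apply: (local_maximum_modulus f a r M) => // k hk; last exact/fM/hr.
  by apply: derivable_cdiff_at; apply/df/hr.
have oC : open C.
  apply/open_normcP => a [Oa fa]; have [r r0 hr] := opOm a Oa.
  have [c hc] := derivable_cdiff_at _ _ _ (df a Oa).
  have n0 : 0 < normc (M%:C - f a).
    rewrite lt_neqAle normc_ge0 andbT eq_sym; apply/eqP => /ComplexField.Normc.eq0_normc.
    by move/eqP; rewrite subr_eq0 => /eqP /esym.
  have n2 : 0 < normc (M%:C - f a) / 2 by rewrite divr_gt0.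
  have [d d0 hd] := cdiff_at_continuous _ _ _ _ hc _ n2.
  exists (Num.min r d) => [|h]; first by rewrite lt_min r0.
  rewrite lt_min => /andP[hhr hhd]; split; first exact: hr.
  by move=> /= E; have := hd h hhd; rewrite E; lra.
have BE : B = Om.
  apply: cOm; first by exists z0.
    by exists B => //; rewrite /B setIA setIid.
  exists (~` C); first exact: open_closedC.
  apply/seteqP; split=> z [Oz fz]; split => //; first by case.
  by apply: contrapT => nf; apply: fz.
by move=> z; rewrite -BE => -[].
Qed.

End MaximumModulus.

(** * Hermitian geometry of column vectors and the operator norm *)

Local Open Scope sesquilinear_scope.

Section HilbertSpace.
Context (R : realType).
Local Notation C := R[i].
Local Notation normc := (@ComplexField.Normc.normc R).

Lemma mulmx_adj m n p (A : 'M[C]_(m, n)) (B : 'M[C]_(n, p)) :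
  (A *m B)^t* = B^t* *m A^t*.
Proof. by rewrite trmx_mul map_mxM. Qed.

Lemma vnorm_ge0 n (v : 'cV[C]_n) : 0 <= vnorm v.
Proof. exact: sqrtr_ge0. Qed.

Lemma vnorm_sqr n (v : 'cV[C]_n) : ((vnorm v) ^+ 2)%:C = (v^t* *m v) 0 0.
Proof.
rewrite /vnorm sqr_sqrtr; last by apply: sumr_ge0 => k _; rewrite addr_ge0 ?sqr_ge0.
rewrite rmorph_sum mxE; apply: eq_bigr => k _ /=.
by rewrite !mxE add_Re2_Im2 normCK mulrC.
Qed.

Lemma vnorm_eq0 n (v : 'cV[C]_n) : vnorm v <= 0 -> v = 0.
Proof.
move=> v0; have : vnorm v == 0 by rewrite eq_le v0 vnorm_ge0.
rewrite sqrtr_eq0 => s0; apply/colP => k; rewrite mxE.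
have : \sum_(k < n) (complex.Re (v k 0) ^+ 2 + complex.Im (v k 0) ^+ 2) == 0.
  by rewrite eq_le s0 sumr_ge0// => j _; rewrite addr_ge0 ?sqr_ge0.
rewrite psumr_eq0 => [|j _]; last by rewrite addr_ge0 ?sqr_ge0.
move/allP => /(_ k); rewrite mem_index_enum => /(_ isT) /=.
rewrite paddr_eq0 ?sqr_ge0// !sqrf_eq0.
by case: (v k 0) => x y /= /andP[/eqP -> /eqP ->].
Qed.

Lemma vnormZ n (c : R) (v : 'cV[C]_n) : 0 <= c -> vnorm (c%:C *: v) = c * vnorm v.
Proof.
move=> c0; apply/eqP; rewrite -(eqrXn2 (n := 2)) ?mulr_ge0 ?vnorm_ge0//.
apply/eqP/complexI; rewrite exprMn [RHS]rmorphM /= !vnorm_sqr !mxE mulr_sumr.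
apply: eq_bigr => k _; rewrite !mxE rmorphM /= [Num.conj c%:C]conjc_real.
by rewrite rmorphXn /=; ring.
Qed.

(** Obtained from the inequality for [dotmx], which pairs row vectors; hence the transposes. *)
Lemma cauchy_schwarz n (x y : 'cV[C]_n) :
  normc ((y^t* *m x) 0 0) <= vnorm y * vnorm x.
Proof.
have E (a b : 'cV[C]_n) : dotmx a^T b^T = (b^t* *m a) 0 0.
  by rewrite dotmxE !mxE; apply: eq_bigr => k _; rewrite !mxE mulrC.
have : `|dotmx x^T y^T| ^+ 2 <= dotmx x^T x^T * dotmx y^T y^T.
  by have [] := CauchySchwarz (@dotmx C n) x^T y^T.
rewrite !E -!vnorm_sqr => H.
rewrite -(ler_pXn2r (n := 2)) ?nnegrE ?mulr_ge0 ?vnorm_ge0//; last first.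
  by case: (_ 0 0) => a b; exact: sqrtr_ge0.
rewrite -lecR exprMn [leRHS]rmorphM /= mulrC [leLHS]rmorphXn; exact: H.
Qed.

(** The equality case of Cauchy-Schwarz: expanding the squared norm of [x - w] gives the squared
    norm of [x] minus that of [w], which is not positive. *)
Lemma eq_of_cdot n (x w : 'cV[C]_n) :
  vnorm x <= vnorm w -> (w^t* *m x) 0 0 = ((vnorm w) ^+ 2)%:C -> x = w.
Proof.
move=> xw wx; apply/eqP; rewrite -subr_eq0; apply/eqP/vnorm_eq0.
have xw' : (x^t* *m w) 0 0 = ((vnorm w) ^+ 2)%:C.
  have -> : x^t* *m w = (w^t* *m x)^t* by rewrite mulmx_adj trmxCK.
  by rewrite 2!mxE wx; exact: conjc_real.
have : ((vnorm (x - w)) ^+ 2)%:C = ((vnorm x) ^+ 2 - (vnorm w) ^+ 2)%:C.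
  rewrite vnorm_sqr.
  have -> : (x - w)^t* = x^t* - w^t* by apply/matrixP => i j; rewrite !mxE rmorphB.
  rewrite mulmxBl !mulmxBr !mxE.
  move: wx xw' (vnorm_sqr n x) (vnorm_sqr n w); rewrite !mxE => -> -> <- <-.
  by rewrite !rmorphB /=; ring.
move/complexI => E.
have : vnorm x ^+ 2 <= vnorm w ^+ 2 by rewrite ler_pXn2r ?nnegrE ?vnorm_ge0.
rewrite -subr_le0 -E => s0.
have /eqP : vnorm (x - w) ^+ 2 == 0 by rewrite eq_le s0 sqr_ge0.
by move/eqP; rewrite sqrf_eq0 => /eqP ->.
Qed.

Lemma unitary_vnorm n (P : 'M[C]_n) (v : 'cV[C]_n) : P \is unitarymx ->
  vnorm (P *m v) = vnorm v.
Proof.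
move=> uP; apply/eqP; rewrite -(eqrXn2 (n := 2)) ?vnorm_ge0//.
apply/eqP/complexI; rewrite !vnorm_sqr mulmx_adj mulmxA -[_ *m P^t* *m P]mulmxA.
by rewrite -invmx_unitary// mulVmx ?unitarymx_unit// mulmx1.
Qed.

(* The maximizer is an eigenvector of A^* A for its largest eigenvalue. *)
Lemma max_stretch n (A : 'M[C]_n.+1) : exists2 v, vnorm v = 1 &
  forall x, vnorm (A *m x) <= vnorm (A *m v) * vnorm x.
Proof.
pose S := A^t* *m A; pose P := spectralmx S; pose D := spectral_diag S.
have uP : P \is unitarymx by exact: spectral_unitarymx.
have hS : S \is hermsymmx.
  by apply/is_hermitianmxP; rewrite expr0 scale1r mulmx_adj trmxCK.
have SE : S = P^t* *m diag_mx D *m P.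
  by rewrite -invmx_unitary//; exact/orthomx_spectralP/hermitian_normalmx.
have DR k : D 0 k = (complex.Re (D 0 k))%:C.
  by have /mxOverP /(_ 0 k) /RRe_real := hermitian_spectral_diag_real hS.
pose sq (z : C) := complex.Re z ^+ 2 + complex.Im z ^+ 2.
(* In eigenbasis coordinates the squared norm of [A *m x] is a sum of squared moduli weighted by the
   eigenvalues, so the largest eigenvalue controls it. *)
have AE x : vnorm (A *m x) ^+ 2 =
    \sum_k complex.Re (D 0 k) * sq ((P *m x) k 0).
  apply: complexI; rewrite vnorm_sqr mulmx_adj mulmxA -[_ *m A^t* *m A]mulmxA -/S SE.
  rewrite -!mulmxA (mulmxA _ (P^t*)) -mulmx_adj mxE rmorph_sum; apply: eq_bigr => k _ /=.
  rewrite mul_diag_mx 3!mxE rmorphM /= add_Re2_Im2 normCK -DR.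
  by rewrite !mxE; ring.
have PE x : vnorm x ^+ 2 = \sum_k sq ((P *m x) k 0).
  rewrite -(unitary_vnorm _ P)// sqr_sqrtr// sumr_ge0// => k _.
  by rewrite addr_ge0 ?sqr_ge0.
have [k0 _ kmax] := @arg_maxP _ R _ ord0 xpredT (fun k => complex.Re (D 0 k)) isT.
pose v := P^t* *m delta_mx k0 (0 : 'I_1).
have Pv : P *m v = delta_mx k0 0 by rewrite mulmxA (unitarymxP uP) mul1mx.
have sqv k : sq ((P *m v) k 0) = (k == k0)%:R.
  rewrite Pv mxE eqxx andbT /sq; case: (k == k0) => /=; rewrite ?expr0n ?expr1n ?addr0//.
have v1 : vnorm v = 1.
  apply/eqP; rewrite -(eqrXn2 (n := 2)) ?vnorm_ge0// expr1n PE (bigD1 k0)//= sqv eqxx.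
  by rewrite big1 ?addr0// => k /negbTE kk; rewrite sqv kk.
exists v => // x.
rewrite -(ler_pXn2r (n := 2)) ?nnegrE ?mulr_ge0 ?vnorm_ge0// exprMn.
have -> : vnorm (A *m v) ^+ 2 = complex.Re (D 0 k0).
  rewrite AE (bigD1 k0)//= sqv eqxx mulr1.
  by rewrite big1 ?addr0// => k /negbTE kk; rewrite sqv kk mulr0.
rewrite AE PE mulr_sumr; apply: ler_sum => k _; apply: ler_wpM2r; last exact: kmax.
by rewrite addr_ge0 ?sqr_ge0.
Qed.

Lemma opnorm_attained n (A : 'M[C]_n.+1) : exists2 v, vnorm v = 1 &
  vnorm (A *m v) = opnorm A /\ forall x, vnorm (A *m x) <= opnorm A * vnorm x.
Proof.
have [v v1 hv] := max_stretch n A.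
suff E : opnorm A = vnorm (A *m v) by exists v => //; rewrite E.
have ub : ubound [set vnorm (A *m v) | v in [set v | vnorm v <= 1]] (vnorm (A *m v)).
  move=> _ [x /= x1 <-]; apply: le_trans (hv x) _.
  by rewrite ler_piMr// vnorm_ge0.
apply/eqP; rewrite eq_le; apply/andP; split.
  by apply: sup_le_ub => //; exists (vnorm (A *m v)); exists v => //=; rewrite v1.
apply: sup_upper_bound; last by exists v => //=; rewrite v1.
by split; [exists (vnorm (A *m v)); exists v => //=; rewrite v1|exists (vnorm (A *m v))].
Qed.

(** For x = A^* u, the squared norm of x is the product of A x with [u]; Cauchy-Schwarz bounds it by
    the norms of A, x and [u], and one factor of x cancels. *)
Lemma opnorm_adj n (A : 'M[C]_n.+1) (u : 'cV[C]_n.+1) :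
  vnorm (A^t* *m u) <= opnorm A * vnorm u.
Proof.
have [v v1 [Av hA]] := opnorm_attained n A.
have M0 : 0 <= opnorm A by rewrite -Av vnorm_ge0.
set x := A^t* *m u.
have [x0|x0] := leP (vnorm x) 0.
  by apply: le_trans x0 _; rewrite mulr_ge0 ?vnorm_ge0.
rewrite -(ler_pM2r x0).
have E : ((vnorm x) ^+ 2)%:C = (u^t* *m (A *m x)) 0 0.
  have xE : x^t* = u^t* *m A by rewrite /x mulmx_adj trmxCK.
  by rewrite vnorm_sqr xE -mulmxA.
have := cauchy_schwarz _ (A *m x) u; rewrite -E.
rewrite /= expr0n addr0 sqrtr_sqr ger0_norm ?sqr_ge0// => H.
rewrite -expr2; apply: le_trans H _.
rewrite [opnorm A * _]mulrC -mulrA ler_wpM2l ?vnorm_ge0//.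
Qed.

(** Gram-Schmidt applied to the matrix whose rows all equal [r] still returns a unitary matrix, and
    its first row is proportional to [r]. *)
Lemma unitary_extend n (r : 'rV[C]_n.+1) : (r *m r^t*) 0 0 = 1 ->
  exists2 S : 'M[C]_n.+1, S \is unitarymx & row 0 S = r.
Proof.
move=> r1; pose A : 'M[C]_n.+1 := \matrix_(i < n.+1) r.
have uS : schmidt A \is unitarymx by exact: schmidt_unitarymx.
exists (schmidt A) => //.
have rA : row 0 A = r by rewrite rowK.
have : (row 0 A <= row 0 (schmidt A))%MS.
  apply: submx_trans (row_schmidt_sub _ _) _.
  apply/sumsmx_subP => k; rewrite leqn0 => /eqP k0.
  have -> : k = 0 by exact: val_inj.
  by rewrite genmxE.
rewrite rA => /sub_rVP [c rc].
have s1 : dotmx (row 0 (schmidt A)) (row 0 (schmidt A)) = 1.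
  by have /row_unitarymxP -> := uS; rewrite eqxx.
(* The normalization of Gram-Schmidt makes the factor [c] nonnegative; having modulus 1, it is 1. *)
have := form1_row_schmidt A 0; rewrite rA.
have cE : dotmx r (row 0 (schmidt A)) = c.
  by rewrite rc dotmxE -scalemxAl mxE -dotmxE s1 mulr1.
rewrite cE => c0.
have : c * c^* = 1.
  rewrite -r1 rc linearZ /= map_mxZ -scalemxAr -scalemxAl 2!mxE -dotmxE s1.
  by rewrite mulr1 mulrC.
rewrite -normCK ger0_norm// => /eqP; rewrite sqrf_eq1 => /orP[] /eqP c1.
  by rewrite rc c1 scale1r.
by move: c0; rewrite c1 oppr_ge0 ler10.
Qed.

Lemma unitarymx_unitary n (A : 'M[C]_n) : A \is unitarymx -> unitary A.
Proof.
move=> uA; rewrite /unitary /adjmx map_trmx; split; last exact/unitarymxP.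
by rewrite -invmx_unitary// mulVmx// unitarymx_unit.
Qed.

Lemma derivable_mulmx n p q (L : 'M[C]_(p, n)) (K : 'M[C]_(n, q))
    (F : C -> 'M[C]_n) (z : C) i j :
  (forall i j, derivable (fun w : C => F w i j) z (1 : C)) ->
  derivable (fun w : C => (L *m F w *m K) i j) z (1 : C).
Proof.
move=> dF.
have -> : (fun w : C => (L *m F w *m K) i j) =
    \sum_(k < n) \sum_(l < n) ((L i l * K k j) \*: (fun w : C => F w l k)).
  apply/funext => w; rewrite fct_sumE mxE; apply: eq_bigr => k _.
  rewrite fct_sumE mxE mulr_suml; apply: eq_bigr => l _ /=.
  by rewrite [LHS]mulrAC.
by apply: derivable_sum => k; apply: derivable_sum => l; exact: derivableZ.
Qed.

End HilbertSpace.

(** * Common singular vectors and the block decomposition *)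

Lemma constant_singular_vectors (R : realType) (n : nat) (Om : set R[i])
    (F : R[i] -> 'M[R[i]]_n.+1) (z0 : R[i]) :
  region Om -> mx_analytic_on Om F -> Om z0 ->
  (forall z, Om z -> opnorm (F z) <= opnorm (F z0)) ->
  exists u v : 'cV[R[i]]_n.+1, [/\ vnorm u = 1, vnorm v = 1 & forall z, Om z ->
    F z *m v = (opnorm (F z0))%:C *: u /\ (F z)^t* *m u = (opnorm (F z0))%:C *: v].
Proof.
move=> rOm aF Oz0 maxF; set M := opnorm (F z0).
have [v v1 [Mv hF0]] := opnorm_attained R n (F z0).
rewrite -/M in Mv hF0.
have M0 : 0 <= M by rewrite -Mv vnorm_ge0.
have [u u1 wu] : exists2 u : 'cV[R[i]]_n.+1, vnorm u = 1 & F z0 *m v = M%:C *: u.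
  (* If [M] is 0 then [F z0] kills [v] and any unit vector can serve as [u]. *)
  have [Mz|Mn0] := eqVneq M 0.
    by exists v => //; rewrite Mz scale0r; apply: vnorm_eq0; rewrite Mv Mz.
  exists ((M^-1)%:C *: (F z0 *m v)).
    by rewrite vnormZ ?invr_ge0// Mv mulVf.
  by rewrite scalerA -rmorphM /= divff// scale1r.
exists u, v; split=> // z Oz.
have hF y (Oy : Om y) x : vnorm (F y *m x) <= M * vnorm x.
  have [_ _ [_ h]] := opnorm_attained R n (F y).
  apply: le_trans (h x) _; apply: ler_wpM2r; [exact: vnorm_ge0|exact: maxF].
have uu : (u^t* *m u) 0 0 = 1 by rewrite -vnorm_sqr u1 expr1n.
have fz : (u^t* *m F z *m v) 0 0 = M%:C.
  apply: (@maximum_modulus R Om (fun z => (u^t* *m F z *m v) 0 0) z0 M) => //.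
  - by move=> y Oy; apply: derivable_mulmx => i j; exact: aF.
  - move=> y Oy; rewrite -mulmxA; apply: le_trans (cauchy_schwarz _ _ _ _) _.
    by rewrite u1 mul1r; apply: le_trans (hF y Oy v) _; rewrite v1 mulr1.
  - by rewrite -mulmxA wu -scalemxAr mxE uu mulr1.
have nMu : vnorm (M%:C *: u) = M by rewrite vnormZ// u1 mulr1.
have nMv : vnorm (M%:C *: v) = M by rewrite vnormZ// v1 mulr1.
have adjZ (x : 'cV[R[i]]_n.+1) : (M%:C *: x)^t* = M%:C *: x^t*.
  by apply/matrixP => i j; rewrite !mxE rmorphM /= [Num.conj M%:C]conjc_real.
split; apply: eq_of_cdot; rewrite ?nMu ?nMv.
- by apply: le_trans (hF z Oz v) _; rewrite v1 mulr1.
- by rewrite adjZ -scalemxAl mxE mulmxA fz expr2 rmorphM.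
- apply: le_trans (opnorm_adj _ _ _ _) _; rewrite u1 mulr1; exact: maxF.
(* The second identity reuses the same scalar, conjugated: its value [M] is real. *)
- have E : v^t* *m ((F z)^t* *m u) = (u^t* *m F z *m v)^t*.
    by rewrite !mulmx_adj trmxCK mulmxA.
  rewrite adjZ -scalemxAl mxE E 2!mxE fz expr2 rmorphM /=.
  by congr (_ * _); exact: conjc_real.
Qed.

(** The factor [c *+ (j == 0)] encodes [c] in the corner and 0 further along. *)
Lemma block_mx_first (K : pzRingType) (m : nat) (c : K) (B : 'M[K]_(1 + m)) :
  (forall j, B 0 j = c *+ (j == 0)) -> (forall i, B i 0 = c *+ (i == 0)) ->
  block_mx (c%:M : 'M[K]_1) 0 0 (drsubmx B) = B.
Proof.
move=> hrow hcol; have l0 : lshift m (0 : 'I_1) = 0 by exact: val_inj.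
have r0 (k : 'I_m) : (rshift 1 k == 0) = false by exact/eqP.
rewrite -[RHS]submxK; congr block_mx; apply/matrixP => i j; rewrite ?ord1 !mxE ?l0.
- by rewrite hrow.
- by rewrite hrow r0.
- by rewrite hcol r0.
Qed.

Theorem theorem4 (R : realType) (n : nat) (hn : (2 <= n)%N)
  (Om : set R[i]) (F : R[i] -> 'M[R[i]]_n) (z0 : R[i]) :
  region Om -> mx_analytic_on Om F -> Om z0 ->
  (forall z, Om z -> opnorm (F z) <= opnorm (F z0)) ->
  exists (U V : 'M[R[i]]_n) (G : R[i] -> 'M[R[i]]_(n - 1)),
    [/\ unitary U, unitary V, mx_analytic_on Om G &
      forall z, Om z ->
        F z = U *m castmx (subnKC (ltnW hn), subnKC (ltnW hn))
                (block_mx ((opnorm (F z0))%:C%:M : 'M[R[i]]_1) 0 0 (G z)) *m V].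
Proof.
(* With [n] in successor form both dimensions compute, so the cast later becomes the identity. *)
case: n hn F => [//|[//|m]] hn F rOm aF Oz0 maxF.
have [u [v [u1 v1 uv]]] := constant_singular_vectors R m.+1 Om F z0 rOm aF Oz0 maxF.
set M := opnorm (F z0) in uv *.
have unit1 (x : 'cV[R[i]]_m.+2) : vnorm x = 1 -> (x^t* *m (x^t*)^t*) 0 0 = 1.
  by move=> x1; rewrite trmxCK -vnorm_sqr x1 expr1n; reflexivity.
have [S uS rS] := unitary_extend R m.+1 _ (unit1 u u1).
have [T uT rT] := unitary_extend R m.+1 _ (unit1 v v1).
(* F in the new bases: the first row of [S] is u^* and the first column of [T^t*] is [v]. *)
pose B z : 'M[R[i]]_(1 + m.+1) := S *m F z *m T^t*.
have Brow z j : Om z -> B z 0 j = M%:C *+ (j == 0).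
  move=> Oz; have [_ Fu] := uv z Oz.
  have -> : B z 0 j = row 0 (B z) 0 j by rewrite [RHS]mxE.
  rewrite /B !row_mul rS.
  (* The adjoint of F^* u = M v; multiplied by [T^t*], the row v^* becomes the first basis row. *)
  have -> : u^t* *m F z = M%:C *: v^t*.
    rewrite -[F z]trmxCK -mulmx_adj Fu.
    by apply/matrixP => i k; rewrite !mxE rmorphM /= [Num.conj M%:C]conjc_real.
  rewrite -rT -scalemxAl -row_mul (unitarymxP uT) !mxE eq_sym.
  by rewrite mulr_natr.
have colM (A A' : 'M[R[i]]_m.+2) : col 0 (A *m A') = A *m col 0 A'.
  by rewrite !colE mulmxA.
have Bcol z i : Om z -> B z i 0 = M%:C *+ (i == 0).
  move=> Oz; have [Fv _] := uv z Oz.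
  have cT : col 0 (T^t*) = v.
    have -> : col 0 (T^t*) = (row 0 T)^t* by apply/matrixP => a b; rewrite !mxE.
    by rewrite rT trmxCK.
  have cS : col 0 (S^t*) = u.
    have -> : col 0 (S^t*) = (row 0 S)^t* by apply/matrixP => a b; rewrite !mxE.
    by rewrite rS trmxCK.
  have -> : B z i 0 = col 0 (B z) i 0 by rewrite [RHS]mxE.
  rewrite /B colM cT -mulmxA Fv -scalemxAr -cS -colM (unitarymxP uS) !mxE.
  by rewrite mulr_natr.
exists (S^t*), T, (fun z => drsubmx (B z)); split.
- by apply: unitarymx_unitary; rewrite trmxC_unitary.
- exact: unitarymx_unitary.
- move=> z Oz i j.
  have -> : (fun w => drsubmx (B w) i j) =
      fun w => (S *m F w *m T^t*) (rshift 1 i) (rshift 1 j).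
    by apply/funext => w; rewrite !mxE.
  by apply: derivable_mulmx => k l; exact: aF.
move=> z Oz; rewrite castmx_id.
have -> : block_mx (M%:C%:M : 'M[R[i]]_1) 0 0 (drsubmx (B z)) = B z.
  by apply: block_mx_first => k; [exact: Brow|exact: Bcol].
rewrite /B !mulmxA -invmx_unitary// mulVmx ?unitarymx_unit// mul1mx.
by rewrite mulmxKtV.
Qed.
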